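(* Let $k\ge1$ be a natural number. If $\Gamma=(A,B,E)$ is a highly computable, computably bipartite graph satisfying the computable expanding Hall's harem condition with respect to $k$ (denoted $c.e.H.h.c.(k)$), then $\Gamma$ has a computable perfect $(1,k)$-matching.
   Context: A bipartite graph $\Gamma=(A,B,E)$ is a graph whose vertex set $V$ is partitioned into $A$ (left vertices) and $B$ (right vertices) with edge set $E\subseteq A\times B$. For a vertex $x$, $N(x)$ is the set of vertices adjacent to $x$, i.e. joined to $x$ by an edge; for $X\subseteq A$ or $X\subseteq B$, $N(X)=\bigcup_{x\in X}N(x)$. $\Gamma$ is locally finite if all $N(x)$ are finite. $\Gamma$ is computable if there is a bijection $\nu:\mathbb{N}\to V$ such that $\{(i,j):(\nu(i),\nu(j))\in E\}$ is computable. A locally finite $\Gamma$ is highly computable if additionally there is a recursive $f:\mathbb{N}\to\mathbb{N}$ with $f(n)=|N(\nu(n))|$ for all $n$. $\Gamma=(A,B,E)$ is computably bipartite if it is computable and $\nu^{-1}(A)$ is a computable set. (The same $\nu$ is used throughout.) $\Gamma$ satisfies $c.e.H.h.c.(k)$ if there is a recursive function $h:\mathbb{N}\to\mathbb{N}$ ($0\in\mathbb{N}$) such that: $h(0)=0$; for all finite $X\subset A$ and all $n$, $h(n)\le|X|$ implies $n\le|N(X)|-k|X|$; for all finite $Y\subset B$ and all $n$, $h(n)\le|Y|$ implies $n\le|N(Y)|-\frac1k|Y|$. A perfect $(1,k)$-matching from $A$ to $B$ is a set $M\subseteq E$ such that (1) for each $a\in A$ there are exactly $k$ vertices $b_1,\dots,b_k\in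 B$ with $(a,b_1),\dots,(a,b_k)\in M$; (2) for each $b\in B$ there is a unique $a\in A$ with $(a,b)\in M$. It is a computable perfect $(1,k)$-matching if there is an algorithm which for each $i$ with $\nu(i)\in A$ finds the tuple $(i_1,\dots,i_k)$ of numbers of the $k$ vertices matched to $\nu(i)$, i.e. $(\nu(i),\nu(i_j))\in M$ for $j=1,\dots,k$, and for each $i$ with $\nu(i)\notin A$ finds $i'$ with $(\nu(i'),\nu(i))\in M$. *)

(* Defs.v *)
From mathcomp Require Import all_boot all_order all_algebra finmap.
From mathcomp Require Import boolp classical_sets functions cardinality.

Set Implicit Arguments.
Unset Strict Implicit.
Unset Printing Implicit Defensive.

Import Order.TTheory GRing.Theory Num.Theory.

Local Open Scope classical_set_scope.
Local Open Scope card_scope.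

(* Total recursive functions of n arguments: the closure of the initial
   functions under composition, primitive recursion and minimization of regular
   functions (every instance of the search succeeds), so partial functions are
   not needed. Each clause specifies f pointwise rather than by a closed term. *)
Inductive recursive : forall n : nat, (n.-tuple nat -> nat) -> Prop :=
| rec_zero (n : nat) (f : n.-tuple nat -> nat) :
    (forall v, f v = 0) -> recursive f
| rec_succ (f : 1.-tuple nat -> nat) :
    (forall v, f v = (thead v).+1) -> recursive f
| rec_proj (n : nat) (i : 'I_n) (f : n.-tuple nat -> nat) :
    (forall v, f v = tnth v i) -> recursive f
| rec_comp (m n : nat) (g : m.-tuple nat -> nat)
    (h : 'I_m -> n.-tuple nat -> nat) (f : n.-tuple nat -> nat) :
    recursive g -> (forall i, recursive (h i)) ->
    (forall v, f v = g [tuple h i v | i < m]) -> recursive f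
| rec_prim (n : nat) (g : n.-tuple nat -> nat) (h : n.+2.-tuple nat -> nat)
    (f : n.+1.-tuple nat -> nat) :
    recursive g -> recursive h ->
    (forall v : n.-tuple nat, f [tuple of 0 :: v] = g v) ->
    (forall x (v : n.-tuple nat), f [tuple of x.+1 :: v] =
                 h [tuple of x :: f [tuple of x :: v] :: v]) ->
    recursive f
| rec_min (n : nat) (g : n.+1.-tuple nat -> nat) (f : n.-tuple nat -> nat) :
    recursive g ->
    (forall v : n.-tuple nat, g [tuple of f v :: v] = 0) ->
    (forall (v : n.-tuple nat) x, x < f v -> g [tuple of x :: v] != 0) ->
    recursive f.

Definition recursive1 (f : nat -> nat) : Prop :=
  recursive (fun v : 1.-tuple nat => f (thead v)).

(* `[< P >] : bool is coerced to 0 or 1, giving the characteristic function. *)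
Definition computable_set (S : set nat) : Prop :=
  recursive (fun v : 1.-tuple nat => nat_of_bool `[< S (thead v) >]).

Definition computable_rel (S : set (nat * nat)) : Prop :=
  recursive (fun v : 2.-tuple nat =>
    nat_of_bool `[< S (tnth v ord0, tnth v ord_max) >]).

Record bipartite_graph (V : choiceType) := BipartiteGraph {
  lefts : set V;
  rights : set V;
  edge : set (V * V);
  lefts_rights_cover : lefts `|` rights = setT;
  lefts_rights_disjoint : lefts `&` rights = set0;
  edge_sub : edge `<=` lefts `*` rights }.

Section Graphs.
Variables (V : choiceType) (G : bipartite_graph V).

(* Edges are oriented from left to right; adjacency is symmetric. *)
Definition nbrs (x : V) : set V := [set y | edge G (x, y) \/ edge G (y, x)].

Definition nbrs_set (X : set V) : set V := \bigcup_(x in X) nbrs x.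

Definition locally_finite : Prop := forall x : V, finite_set (nbrs x).

(* Meaningful for finite sets only (fset_set is empty otherwise). *)
Definition ncard (X : set V) : nat := #|` fset_set X |.

Definition computable_graph (nu : nat -> V) : Prop :=
  bijective nu /\
  computable_rel [set ij | edge G (nu ij.1, nu ij.2)].

Definition highly_computable (nu : nat -> V) : Prop :=
  [/\ computable_graph nu, locally_finite &
      exists f : nat -> nat, recursive1 f /\ forall n, f n = ncard (nbrs (nu n))].

Definition computably_bipartite (nu : nat -> V) : Prop :=
  computable_graph nu /\ computable_set (nu @^-1` lefts G).

(* The computable expanding Hall's harem condition c.e.H.h.c.(k), for locally
   finite G. *)
Definition ceHhc (k : nat) : Prop :=
  exists h : nat -> nat,
    [/\ recursive1 h,
        h 0 = 0,
        forall X : set V, finite_set X -> X `<=` lefts G ->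
          forall n, h n <= ncard X ->
          (n%:R <= (ncard (nbrs_set X))%:R - k%:R * (ncard X)%:R :> rat)%R &
        forall Y : set V, finite_set Y -> Y `<=` rights G ->
          forall n, h n <= ncard Y ->
          (n%:R <= (ncard (nbrs_set Y))%:R - 1 / k%:R * (ncard Y)%:R :> rat)%R].

Definition perfect_matching (k : nat) (M : set (V * V)) : Prop :=
  [/\ M `<=` edge G,
      forall a, lefts G a -> [set b | rights G b /\ M (a, b)] #= `I_k &
      forall b, rights G b -> exists! a, lefts G a /\ M (a, b)].

(* As the left side is computable, an algorithm for the left (resp. right)
   indices is the same as a total recursive function with arbitrary values on
   the other indices; p j is the j-th coordinate of the k-tuple. *)
Definition computable_perfect_matching (nu : nat -> V) (k : nat)
    (M : set (V * V)) : Prop :=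
  [/\ perfect_matching k M,
      exists p : 'I_k -> nat -> nat,
        (forall j, recursive1 (p j)) /\
        (forall i, lefts G (nu i) ->
           injective (p ^~ i) /\ forall j, M (nu i, nu (p j i))) &
      exists q : nat -> nat,
        recursive1 q /\
        (forall i, ~ lefts G (nu i) -> M (nu (q i), nu i))].

End Graphs.

(* Main.v *)
Require Import Defs.
From mathcomp Require Import all_boot all_order all_algebra finmap.
From mathcomp Require Import boolp classical_sets functions cardinality.
From mathcomp Require Import zify.

Set Implicit Arguments.
Unset Strict Implicit.
Unset Printing Implicit Defensive.

Import Order.TTheory GRing.Theory Num.Theory.

(** The case k = 1 carries everything. For k > 1 replace every left vertex by
    k copies with the same neighbours, leaving the right side alone: the harem
    condition for k becomes the expanding Hall condition for k = 1, with the
    function [k * h] ([copy_expand]), and a perfect matching of the new graph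
    is a perfect (1,k)-matching of the old one.

    In a bipartite graph call a finite set P of vertices removable if Hall's
    condition still holds, on both sides, after P is deleted ([hall]). If P is
    removable and x is a further vertex, then some neighbour y of x leaves
    P + x + y removable ([hall_extend]). This is proved by counting tight sets,
    those with exactly as many free neighbours as elements, so that neither
    Hall's theorem nor a compactness argument is needed. Consequently a
    matching of a removable set extends to cover any finite set of vertices
    ([hall_cover]).

    To choose partners effectively, removability must be recognised in finite
    time. Let f be a matching that is right on a large ball around the vertices
    below s, and let P consist of these vertices and their partners, so that
    |P| <= 2s. Sets of at least [h (2s)] vertices satisfy Hall's condition
    after deleting P, because the expansion makes up for the loss of 2s
    neighbours. A smaller set X must miss one of [h (2s)] disjoint shells
    around the vertices below s, and thus splits into a near part, where f
    itself is an injection into the free neighbours, and a far part, whose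
    neighbours are disjoint from P and from those of the near part
    ([correct_hall]). So the restriction to s of any finite matching that is
    right up to a computable horizon extends to a matching right up to any
    further horizon. Searching successively for codes of such finite matchings,
    the one found at stage s + 1 agreeing below s with the one found at stage s,
    never fails, and the limit is a computable perfect matching
    ([computable_matching]). *)

(** * Closure properties of the recursive functions *)

(** Recursiveness of a function of an infinite valuation [e] of the variables
    [e 0], [e 1], ..., of which only finitely many matter. Leaving the number
    of variables implicit makes substitution and binding uniform: under a
    binder, the bound variable is [e 0] and the others are shifted. *)
Definition computable (F : (nat -> nat) -> nat) : Prop :=
  exists n, (forall e e', (forall i, i < n -> e i = e' i) -> F e = F e') /\
            recursive (fun v : n.-tuple nat => F (nth 0 v)).

(** Decidability, through the characteristic function. *)
Definition computableb (P : (nat -> nat) -> bool) : Prop :=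
  computable (fun e => nat_of_bool (P e)).

Lemma eq_recursive n (f g : n.-tuple nat -> nat) :
  f =1 g -> recursive f -> recursive g.
Proof. by move=> /funext ->. Qed.

Lemma recursive_widen F n m :
  (forall e e', (forall i, i < n -> e i = e' i) -> F e = F e') ->
  recursive (fun v : n.-tuple nat => F (nth 0 v)) -> n <= m ->
  recursive (fun v : m.-tuple nat => F (nth 0 v)).
Proof.
move=> dF rF le_nm.
apply: (rec_comp (h := fun i (v : m.-tuple nat) => tnth v (widen_ord le_nm i)))
  rF _ _ => [i|v].
  exact: rec_proj.
apply: dF => i lt_in.
rewrite -[i]/(val (Ordinal lt_in)) -tnth_nth tnth_mktuple.
by rewrite (tnth_nth 0).
Qed.

Lemma computable_comp F (G : nat -> (nat -> nat) -> nat) :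
  computable F -> (forall i, computable (G i)) ->
  computable (fun e => F (fun i => G i e)).
Proof.
move=> [n [dF rF]] /choice[s sP]; pose m := \max_(i < n) s i.
have le_sm i : i < n -> s i <= m.
  by move=> lt_in; rewrite (leq_bigmax (Ordinal lt_in)).
exists m; split=> [e e' ee'|].
  apply: dF => i lt_in; apply: (sP i).1 => j lt_js; apply: ee'.
  exact: leq_trans (le_sm _ lt_in).
apply: (rec_comp (h := fun (i : 'I_n) (v : m.-tuple nat) => G i (nth 0 v)))
  rF _ _ => [i|v].
  by case: (sP i) => dG rG; apply: recursive_widen dG rG (le_sm _ (ltn_ord i)).
apply: dF => i lt_in.
by rewrite -[i]/(val (Ordinal lt_in)) -tnth_nth tnth_mktuple.
Qed.

Lemma computable_var i : computable (fun e => e i).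
Proof.
exists i.+1; split=> [e e' -> //|].
by apply: (rec_proj (i := ord_max)) => v; rewrite (tnth_nth 0).
Qed.

Lemma computable_app1 F a :
  computable (fun e => F (e 0)) -> computable a ->
  computable (fun e => F (a e)).
Proof. by move=> cF ca; apply: computable_comp cF (fun=> ca). Qed.

Lemma computable_app2 F a b :
  computable (fun e => F (e 0) (e 1)) -> computable a -> computable b ->
  computable (fun e => F (a e) (b e)).
Proof.
move=> cF ca cb.
by apply: (computable_comp (G := fun i => if i is 0 then a else b)) cF _ => -[].
Qed.

Lemma computable_app3 F a b c :
  computable (fun e => F (e 0) (e 1) (e 2)) ->
  computable a -> computable b -> computable c ->
  computable (fun e => F (a e) (b e) (c e)).
Proof.
move=> cF ca cb cc.
by apply: (computable_comp
  (G := fun i => match i with 0 => a | 1 => b | _ => c end)) cF _ => -[|[]].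
Qed.

Lemma computable_const n : computable (fun=> n).
Proof.
elim: n => [|n IHn]; first by exists 0; split=> //; apply: rec_zero.
apply: (computable_app1 (F := succn)) IHn; exists 1; split=> [e e' -> //|].
by apply: rec_succ => v; rewrite (tuple_eta v).
Qed.

Lemma computable_succ a : computable a -> computable (fun e => (a e).+1).
Proof.
apply: computable_app1; exists 1; split=> [e e' -> //|].
by apply: rec_succ => v; rewrite (tuple_eta v).
Qed.

(** The value at [n] of the function defined by primitive recursion. *)
Fixpoint primrec (base : nat) (step : nat -> nat -> nat) n :=
  if n is m.+1 then step m (primrec base step m) else base.

Lemma computable_primrec base step a :
  computable base ->
  computable (fun e => step (e 0) (e 1) (fun i => e i.+2)) ->
  computable a ->
  computable (fun e => primrec (base e) (fun x y => step x y e) (a e)).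
Proof.
move=> [nb [db rb]] [ns [ds rs]] ca.
pose n := maxn nb ns.
have db' e e' : (forall i, i < n -> e i = e' i) -> base e = base e'.
  by move=> ee'; apply: db => i lt_i; apply: ee'; rewrite leq_max lt_i.
have ds' x y e e' : (forall i, i < n -> e i = e' i) -> step x y e = step x y e'.
  move=> ee'.
  pose up e i : nat := match i with 0 => x | 1 => y | j.+2 => e j end.
  apply: (ds (up e) (up e')) => -[|[|i]] //= lt_i; apply: ee'.
  by rewrite /n; lia.
pose H (e : nat -> nat) := primrec (base (fun i => e i.+1))
  (fun x y => step x y (fun i => e i.+1)) (e 0).
suff cH : computable H.
  by apply: (computable_comp (G := fun i => if i is j.+1 then fun e => e j else a))
    cH _ => -[|i] //; apply: computable_var.
exists n.+1; split.
  move=> e e' ee'; rewrite /H ee' //.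
  elim: (e' 0) => [|x IHx] /=.
    by apply: db' => i lt_i; apply: ee'.
  by rewrite IHx; apply: ds' => i lt_i; apply: ee'.
apply: (rec_prim (g := fun v : n.-tuple nat => base (nth 0 v))
  (h := fun v : n.+2.-tuple nat =>
          step (nth 0 v 0) (nth 0 v 1) (fun i => nth 0 v i.+2))) => //.
  by apply: recursive_widen rb _ => //; rewrite leq_maxl.
apply: (recursive_widen (F := fun e => step (e 0) (e 1) (fun i => e i.+2))
  ds rs).
by rewrite /n; lia.
Qed.

(** The unbounded search operator; the value is 0 when the search fails. *)
Definition least (P : pred nat) : nat :=
  if pselect (exists n, P n) is left exP then ex_minn exP else 0.

Lemma leastP (P : pred nat) : (exists n, P n) -> P (least P).
Proof. by rewrite /least; case: pselect => // exP _; case: ex_minnP. Qed.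

Lemma least_min (P : pred nat) n : n < least P -> ~~ P n.
Proof.
rewrite /least; case: pselect => // exP; case: ex_minnP => m _ min_m lt_nm.
by apply/negP => /min_m; rewrite leqNgt lt_nm.
Qed.

Lemma least_eq (P : pred nat) n :
  P n -> (forall m, m < n -> ~~ P m) -> least P = n.
Proof.
move=> Pn min_n; have Pl : P (least P) by apply: leastP; exists n.
apply/eqP; rewrite eqn_leq leqNgt [n <= _]leqNgt.
by apply/andP; split; apply/negP; [move/least_min | move/min_n]; rewrite ?Pn ?Pl.
Qed.

Lemma computable_least (P : nat -> (nat -> nat) -> bool) :
  computableb (fun e => P (e 0) (fun i => e i.+1)) ->
  (forall e, exists n, P n e) ->
  computable (fun e => least (P ^~ e)).
Proof.
move=> cP exP.
(* Minimization looks for a zero, hence the test that is 0 on true. *)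
have /= [n [dP rP]] : computable
    (fun e => primrec 1 (fun _ _ => 0) (P (e 0) (fun i => e i.+1))).
  by apply: (computable_app1 (F := primrec 1 (fun _ _ => 0))) cP;
    apply: (computable_primrec (base := fun=> 1) (step := fun _ _ _ => 0)
    (a := fun e => e 0)); do ?[exact: computable_const | exact: computable_var].
have dP' x e e' : (forall i, i < n -> e i = e' i) -> P x e = P x e'.
  move=> ee'.
  pose up e i : nat := match i with 0 => x | j.+1 => e j end.
  have: primrec 1 (fun _ _ => 0) (P x e) = primrec 1 (fun _ _ => 0) (P x e').
    by apply: (dP (up e) (up e')) => -[|i] //= lt_i; apply: ee'; lia.
  by case: (P x e) (P x e') => -[].
exists n; split=> [e e' ee'|].
  by congr least; apply/funext => x; apply: dP'.
apply: (rec_min (g := fun v : n.+1.-tuple nat =>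
  primrec 1 (fun _ _ => 0) (P (nth 0 v 0) (fun i => nth 0 v i.+1)))).
- exact: (recursive_widen dP rP).
- by move=> v /=; have /= -> := leastP (exP (nth 0 v)).
- by move=> v x /= /least_min/negPf ->.
Qed.

Lemma computable_add a b :
  computable a -> computable b -> computable (fun e => a e + b e).
Proof.
move=> ca cb.
have -> : (fun e => a e + b e) = fun e => primrec (a e) (fun _ y => y.+1) (b e).
  by apply/funext => e; elim: (b e) => [|n /= <-]; rewrite ?addn0 ?addnS.
apply: (computable_primrec (step := fun _ y _ => y.+1)) => //.
exact/computable_succ/computable_var.
Qed.

Lemma computable_mul a b :
  computable a -> computable b -> computable (fun e => a e * b e).
Proof.
apply: computable_app2.
have -> : (fun e : nat -> nat => e 0 * e 1) =
    fun e => primrec 0 (fun _ y => y + e 0) (e 1).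
  by apply/funext => e; elim: (e 1) => [|n /= <-]; rewrite ?muln0 ?mulnSr.
apply: (computable_primrec (base := fun=> 0) (step := fun _ y e => y + e 0)
  (a := fun e => e 1)); do ?[exact: computable_const | exact: computable_var].
by apply: computable_add; apply: computable_var.
Qed.

Lemma computable_sub a b :
  computable a -> computable b -> computable (fun e => a e - b e).
Proof.
move=> ca cb.
have -> : (fun e => a e - b e) = fun e => primrec (a e) (fun _ y => y.-1) (b e).
  by apply/funext => e; elim: (b e) => [|n /= <-]; rewrite ?subn0 ?subnS.
apply: (computable_primrec (step := fun _ y _ => y.-1)) => //.
have -> : (fun e : nat -> nat => (e 1).-1) =
    fun e => primrec 0 (fun x _ => x) (e 1).
  by apply/funext => e; case: (e 1).
apply: (computable_primrec (base := fun=> 0) (step := fun x _ _ => x)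
  (a := fun e => e 1)); do ?[exact: computable_const | exact: computable_var].
Qed.

Lemma computable_exp a b :
  computable a -> computable b -> computable (fun e => a e ^ b e).
Proof.
apply: computable_app2.
have -> : (fun e : nat -> nat => e 0 ^ e 1) =
    fun e => primrec 1 (fun _ y => y * e 0) (e 1).
  by apply/funext => e; elim: (e 1) => [|n /= <-]; rewrite ?expn0 ?expnSr.
apply: (computable_primrec (base := fun=> 1) (step := fun _ y e => y * e 0)
  (a := fun e => e 1)); do ?[exact: computable_const | exact: computable_var].
by apply: computable_mul; apply: computable_var.
Qed.

Lemma computable_sum F a :
  computable (fun e => F (e 0) (fun i => e i.+1)) -> computable a ->
  computable (fun e => \sum_(i < a e) F i e).
Proof.
move=> cF ca.
have -> : (fun e => \sum_(i < a e) F i e) =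
    fun e => primrec 0 (fun x y => y + F x e) (a e).
  apply/funext => e; elim: (a e) => [|n /= <-]; first by rewrite big_ord0.
  by rewrite big_ord_recr.
apply: (computable_primrec (base := fun=> 0) (step := fun x y e => y + F x e));
  [exact: computable_const | | exact: ca].
apply: computable_add; first exact: computable_var.
by apply: (computable_comp (G := fun i => if i is j.+1 then fun e => e j.+2
  else fun e => e 0)) cF _ => -[|i]; apply: computable_var.
Qed.

Lemma computableb_leq a b :
  computable a -> computable b -> computableb (fun e => a e <= b e).
Proof.
move=> ca cb; rewrite /computableb.
have -> : (fun e => nat_of_bool (a e <= b e)) = fun e => 1 - (a e - b e).
  by apply/funext => e; rewrite /leq; case: (a e - b e).
by apply: computable_sub; [apply: computable_const | apply: computable_sub].
Qed.

Lemma computableb_and P Q :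
  computableb P -> computableb Q -> computableb (fun e => P e && Q e).
Proof.
move=> cP cQ; rewrite /computableb.
under eq_fun do rewrite -mulnb.
exact: computable_mul.
Qed.

Lemma computableb_neg P : computableb P -> computableb (fun e => ~~ P e).
Proof.
move=> cP; rewrite /computableb.
have -> : (fun e => nat_of_bool (~~ P e)) = fun e => 1 - P e.
  by apply/funext => e; case: (P e).
by apply: computable_sub; first exact: computable_const.
Qed.

Lemma computableb_or P Q :
  computableb P -> computableb Q -> computableb (fun e => P e || Q e).
Proof.
move=> cP cQ.
have -> : (fun e => P e || Q e) = fun e => ~~ (~~ P e && ~~ Q e).
  by apply/funext => e; rewrite negb_and !negbK.
by apply/computableb_neg/computableb_and; apply: computableb_neg.
Qed.

Lemma computableb_imp P Q :
  computableb P -> computableb Q -> computableb (fun e => P e ==> Q e).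
Proof.
move=> cP cQ; under eq_fun do rewrite implybE.
by apply: computableb_or => //; apply: computableb_neg.
Qed.

Lemma computableb_eq a b :
  computable a -> computable b -> computableb (fun e => a e == b e).
Proof.
move=> ca cb; under eq_fun do rewrite eqn_leq.
by apply: computableb_and; apply: computableb_leq.
Qed.

Lemma computableb_all P a :
  computableb (fun e => P (e 0) (fun i => e i.+1)) -> computable a ->
  computableb (fun e => all (P ^~ e) (iota 0 (a e))).
Proof.
move=> cP ca.
have -> : (fun e => all (P ^~ e) (iota 0 (a e))) =
    fun e => \sum_(i < a e) ~~ P i e == 0.
  apply/funext => e; rewrite sum_nat_eq0; apply/allP/forallP => /= allP i.
    have := allP i; rewrite mem_iota /=; case: (P i e) => //.
    by move=> /(_ (ltn_ord _)).
  rewrite mem_iota add0n => /= lt_i.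
  by have := allP (Ordinal lt_i) => /=; case: (P i e).
apply: computableb_eq; last exact: computable_const.
exact/(computable_sum (F := fun i e => nat_of_bool (~~ P i e)))/ca/computableb_neg.
Qed.

Lemma computable_div a b :
  computable a -> computable b -> computable (fun e => a e %/ b e).
Proof.
apply: computable_app2.
(* Division by 0 gives 0: the first disjunct stops the search at once. *)
pose P q (e : nat -> nat) := (e 1 == 0) || (e 0 < q.+1 * e 1).
have Pdiv e : P (e 0 %/ e 1) e.
  by rewrite /P; have [->|e1_gt0] := posnP (e 1); rewrite ?eqxx // ltn_ceil ?orbT.
have -> : (fun e : nat -> nat => e 0 %/ e 1) = fun e => least (P ^~ e).
  apply/funext => e; apply/esym/least_eq => // q lt_q.
  rewrite /P; have [e1|e1_gt0] := posnP (e 1); first by rewrite e1 divn0 in lt_q.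
  by rewrite -leqNgt -leq_divRL.
apply: computable_least; last by move=> e; exists (e 0 %/ e 1).
apply: computableb_or.
  by apply: computableb_eq; [apply: computable_var | apply: computable_const].
apply: computableb_leq; first exact/computable_succ/computable_var.
by apply: computable_mul; [apply/computable_succ|]; apply: computable_var.
Qed.

Lemma computable_mod a b :
  computable a -> computable b -> computable (fun e => a e %% b e).
Proof.
move=> ca cb.
have -> : (fun e => a e %% b e) = fun e => a e - a e %/ b e * b e.
  by apply/funext => e; rewrite {2}(divn_eq (a e) (b e)) addKn.
apply: computable_sub => //; apply: computable_mul => //; exact: computable_div.
Qed.

Lemma recursive1P f : recursive1 f <-> computable (fun e => f (e 0)).
Proof.
split=> [rf|[n [df rf]]].
  exists 1; split=> [e e' -> //|].
  by apply: eq_recursive rf => v; rewrite (tuple_eta v).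
apply: (rec_comp (h := fun _ v => thead v) rf) => [_|v].
  by apply: (rec_proj (i := ord0)) => v.
apply: (df (fun=> thead v)) => i lt_in.
by rewrite -[i]/(val (Ordinal lt_in)) -tnth_nth tnth_mktuple.
Qed.

Lemma computable_setP S :
  computable_set S -> computableb (fun e => `[< S (e 0) >]).
Proof. by move=> rS; apply/(recursive1P (fun x => `[< S x >])). Qed.

Lemma computable_relP S :
  computable_rel S -> computableb (fun e => `[< S (e 0, e 1) >]).
Proof.
move=> rS; exists 2; split=> [e e' ee'|]; first by rewrite !ee'.
by apply: eq_recursive rS => v; rewrite !(tnth_nth 0).
Qed.

Lemma computableb_app1 (P : nat -> bool) a :
  computableb (fun e => P (e 0)) -> computable a ->
  computableb (fun e => P (a e)).
Proof. exact: (computable_app1 (F := fun x => nat_of_bool (P x))). Qed.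

Lemma computableb_app2 (P : nat -> nat -> bool) a b :
  computableb (fun e => P (e 0) (e 1)) -> computable a -> computable b ->
  computableb (fun e => P (a e) (b e)).
Proof. exact: (computable_app2 (F := fun x y => nat_of_bool (P x y))). Qed.

(** * Removing an edge from a graph with Hall's property *)

Section HallStep.
Local Open Scope fset_scope.

Variables (T : choiceType) (vert side : pred T) (nb : T -> {fset T}).
Hypothesis nb_sym : forall u v, (v \in nb u) = (u \in nb v).
Hypothesis nb_side : forall u v, v \in nb u -> side v = ~~ side u.

(** The set of all neighbours of the elements of [X]. *)
Definition nbset (X : {fset T}) : {fset T} := \bigcup_(x <- X) nb x.

Lemma nbsetP X v : reflect (exists2 u, u \in X & v \in nb u) (v \in nbset X).
Proof.
apply: (iffP (bigfcupP _ _ _ _)) => [[u /andP[uX _]]|[u uX]] uv; exists u => //.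
by rewrite uX.
Qed.

Lemma nbsetU X Y : nbset (X `|` Y) = nbset X `|` nbset Y.
Proof.
apply/fsetP => v; rewrite in_fsetU; apply/nbsetP/orP.
  by case=> u /fsetUP[] uX uv; [left|right]; apply/nbsetP; exists u.
by case=> /nbsetP[u uX uv]; exists u; rewrite // in_fsetU uX ?orbT.
Qed.

Lemma nbsetS X Y : X `<=` Y -> nbset X `<=` nbset Y.
Proof.
move=> /fsubsetP sXY; apply/fsubsetP => v /nbsetP[u uX uv].
by apply/nbsetP; exists u => //; apply: sXY.
Qed.

(** [X] is a set of vertices of side [c], none of which lies in [P]. *)
Definition onside c (P X : {fset T}) : Prop :=
  forall u, u \in X -> [&& vert u, side u == c & u \notin P].

(** Hall's condition for both sides of the graph with the vertices of [P]
    deleted. *)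
Definition hall (P : {fset T}) : Prop :=
  forall c X, onside c P X -> #|` X| <= #|` nbset X `\` P|.

Lemma onsideU c P X Y : onside c P X -> onside c P Y -> onside c P (X `|` Y).
Proof. by move=> oX oY u /fsetUP[/oX|/oY]. Qed.

Lemma onsideS c P X Y : X `<=` Y -> onside c P Y -> onside c P X.
Proof. by move=> /fsubsetP sXY oY u /sXY/oY. Qed.

Section Tight.
Variable P : {fset T}.
Hypothesis hallP : hall P.

Let free X := nbset X `\` P.

(** A set with as many free neighbours as elements: no free neighbour of it
    can be given away. *)
Definition tight c X := onside c P X /\ #|` free X| = #|` X|.

Let freeU X Y : free (X `|` Y) = free X `|` free Y.
Proof. by rewrite /free nbsetU fsetDUl. Qed.

Let freeI X Y : free (X `&` Y) `<=` free X `&` free Y.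
Proof. by rewrite fsubsetI !fsetSD ?nbsetS ?fsubsetIl ?fsubsetIr. Qed.

(** By submodularity of the number of free neighbours. *)
Lemma tightU c X Y : tight c X -> tight c Y -> tight c (X `|` Y).
Proof.
move=> [oX eX] [oY eY]; split; first exact: onsideU.
have := hallP (onsideU oX oY); have := hallP (onsideS (fsubsetIl X Y) oX).
have := fsubset_leq_card (freeI X Y); rewrite -/(free _) -/(free (_ `|` _)).
rewrite freeU; have := cardfsUI X Y; have := cardfsUI (free X) (free Y).
lia.
Qed.

Lemma tightI c X Y : tight c X -> tight c Y ->
  tight c (X `&` Y) /\ free (X `&` Y) = free X `&` free Y.
Proof.
move=> [oX eX] [oY eY]; have oXY := onsideS (fsubsetIl X Y) oX.
have := hallP (onsideU oX oY); have := hallP oXY.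
have := fsubset_leq_card (freeI X Y); rewrite -/(free _) -/(free (_ `|` _)).
rewrite freeU; have := cardfsUI X Y; have := cardfsUI (free X) (free Y).
move=> *; split; first by split=> //; lia.
by apply/eqP; rewrite eqEfcard freeI /=; lia.
Qed.

Lemma tight0 c : tight c fset0.
Proof.
split=> [u|]; first by rewrite in_fset0.
by apply/eqP; rewrite /free /nbset big_seq_fset0 fset0D.
Qed.

Lemma tight_cover c x (S : seq T) :
  (forall y, y \in S -> exists X, [/\ tight c X, x \notin X & y \in free X]) ->
  exists X, [/\ tight c X, x \notin X & {subset S <= free X}].
Proof.
elim: S => [_|y S IHS tS].
  by exists fset0; split; rewrite ?in_fset0 //; apply: tight0.
have [z zS|X [tX xX sX]] := IHS; first by apply: tS; rewrite inE zS orbT.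
have [Y [tY xY yY]] := tS y (mem_head _ _).
exists (X `|` Y); split; first exact: tightU.
  by rewrite in_fsetU negb_or xX.
by move=> z; rewrite inE freeU in_fsetU => /predU1P[->|/sX->//]; rewrite yY orbT.
Qed.

(** If deleting [z] ruins Hall's condition for [X], then [X] is tight and [z]
    is one of its neighbours. *)
Lemma hall_defect c X z : onside c P X -> #|` free X `\ z| < #|` X| ->
  tight c X /\ z \in free X.
Proof.
move=> oX; have := hallP oX; have := cardfsD1 z (free X); rewrite -/(free X).
case: (z \in free X) => /= eX le_X lt_X; last lia.
by split=> //; split=> //; lia.
Qed.

(** There are two obstructions to using the edge [x y]: a tight set on the side
    of [x] that needs [y], or a tight set on the side of [y] that needs [x]. *)
Lemma not_hallU1 x y : y \in nb x -> y \notin P -> ~ hall (x |` (y |` P)) ->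
  (exists X, [/\ tight (side x) X, x \notin X & y \in free X]) \/
  (exists Y, [/\ tight (~~ side x) Y, y \notin Y & x \in free Y]).
Proof.
move=> xy yP; rewrite /hall => /existsNP[c] /existsNP[X] /not_implyP[oX].
move=> /negP; rewrite -ltnNge => ltX.
have oPX : onside c P X.
  by move=> u /oX; rewrite !inE !negb_or => /and3P[-> -> /and3P[_ _ ->]].
have xX : x \notin X by apply/negP => /oX; rewrite !inE eqxx !andbF.
have yX : y \notin X by apply/negP => /oX; rewrite !inE eqxx orbT !andbF.
have opp w z : z \in X -> w \in nb z -> side w = ~~ c.
  by move=> /oX/and3P[_ /eqP <- _] /nb_side.
have [cx|cx] := eqVneq c (side x).
  left; exists X.
  have [|tX yfX] := @hall_defect c X y oPX; last by rewrite -cx.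
  apply: leq_ltn_trans ltX; apply/fsubset_leq_card/fsubsetP => w.
  rewrite in_fsetD1 => /andP[w_y]; rewrite !in_fsetD => /andP[wP wX].
  rewrite wX !in_fset1U !negb_or w_y wP !andbT.
  apply/eqP => wx; move: wX; rewrite wx => /nbsetP[z /opp zX /zX].
  by rewrite cx; case: (side x).
right; exists X.
have {}cx : c = ~~ side x by move: cx; case: (c) (side x) => -[].
have [|tX yfX] := @hall_defect c X x oPX; last by rewrite -cx.
apply: leq_ltn_trans ltX; apply/fsubset_leq_card/fsubsetP => w.
rewrite in_fsetD1 => /andP[w_y]; rewrite !in_fsetD => /andP[wP wX].
rewrite wX !in_fset1U !negb_or w_y wP !andbT.
apply/eqP => wy; move: wX; rewrite wy => /nbsetP[z /opp zX /zX].
by rewrite cx (nb_side xy); case: (side x).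
Qed.

(** The main combinatorial step. If there is no tight set needing [x], then
    all the neighbours of [x] are needed by tight sets avoiding [x], and adding
    [x] to their union violates Hall's condition. Otherwise let [Y] be the least
    tight set needing [x]; its elements adjacent to [x] are needed by a tight
    set [X] avoiding [x]. Comparing sizes for [X] minus the neighbours of [Y]
    and for [Y] minus the neighbours of [X], which also loses the neighbour
    [x], yields a violation of Hall's condition. *)
Lemma hall_extend x : vert x -> x \notin P ->
  exists y, [/\ y \in nb x, y \notin P & hall (x |` (y |` P))].
Proof.
move=> vx xP; apply: contrapT => noy.
set c := side x.
have dicho y : y \in nb x `\` P ->
  (exists X, [/\ tight c X, x \notin X & y \in free X]) \/
  (exists Y, [/\ tight (~~ c) Y, y \notin Y & x \in free Y]).
  rewrite inE => /andP[yP xy]; apply: not_hallU1 => // hy.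
  by apply: noy; exists y.
have [[Y xY]|noY] := pselect (exists Y, tight (~~ c) Y /\ x \in free Y); last first.
  have [y /dicho[//|[Y [tY _ xY]]]|X [[oX eX] xX sX]] :=
      @tight_cover c x (nb x `\` P).
    by case: noY; exists Y.
  have oX' : onside c P (x |` X).
    by apply: onsideU => // u /fset1P ->; rewrite vx eqxx.
  have := hallP oX'; rewrite -/(free _) freeU.
  have -> : free [fset x] `|` free X = free X.
    apply/fsetUidPr/fsubsetP => z; rewrite inE => /andP[zP /nbsetP[u /fset1P ->] xz].
    by apply: sX; rewrite inE zP.
  by rewrite eX cardfsU1 xX; lia.
(* Descend to a least tight set [Y] with [x] among its neighbours. *)
have [n] := ubnP #|` Y|; elim: n Y xY => // n IHn Y [tY xY] ltY.
have [minY|] := pselect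
  (forall Z, tight (~~ c) Z -> x \in free Z -> Y `<=` Z); last first.
  move=> /existsNP[Z] /not_implyP[tZ] /not_implyP[xZ nYZ].
  have [tI eI] := tightI tY tZ.
  apply: (IHn (Y `&` Z)); first by rewrite eI in_fsetI xY.
  have : #|` Y `&` Z| < #|` Y|.
    by apply/fproper_ltn_card; rewrite fproperE fsubsetIl fsubsetI fsubset_refl; apply/negP.
  by move: ltY; lia.
(* The second obstruction cannot arise from an element of [Y], since the tight
   set involved would contain [Y]. *)
have [y|X [[oX eX] xX sX]] := @tight_cover c x (Y `&` (nb x `\` P)).
  rewrite in_fsetI => /andP[yY /dicho[//|[Z [tZ yZ xZ]]]].
  by move/fsubsetP: (minY _ tZ xZ) => /(_ y yY); rewrite (negPf yZ).
have [oY eY] := tY.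
have := hallP (onsideS (fsubsetDl Y (free X)) oY).
have : free (Y `\` free X) `<=` free Y `\` (x |` X).
  apply/fsubsetP => z /fsetDP[/nbsetP[u /fsetDP[uY uX] uz] zP].
  have uP : u \notin P by case/and3P: (oY _ uY).
  rewrite in_fsetD in_fset1U negb_or [_ \in free _]in_fsetD zP /=; apply/andP; split; last first.
    by apply/nbsetP; exists u.
  apply/andP; split.
    apply: contra uX => /eqP zx; apply: sX.
    by rewrite !inE uY uP nb_sym -zx.
  apply: contra uX => zX; rewrite inE uP /=.
  by apply/nbsetP; exists z => //; rewrite nb_sym.
have := hallP (onsideS (fsubsetDl X (free Y)) oX).
have : free (X `\` free Y) `<=` free X `\` Y.
  apply/fsubsetP => z /fsetDP[/nbsetP[u /fsetDP[uX uY] uz] zP].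
  have uP : u \notin P by case/and3P: (oX _ uX).
  rewrite in_fsetD [_ \in free _]in_fsetD zP /=; apply/andP; split; last first.
    by apply/nbsetP; exists u.
  apply: contra uY => zY; rewrite inE uP /=.
  by apply/nbsetP; exists z => //; rewrite nb_sym.
rewrite -/(free (X `\` _)) -/(free (Y `\` _)).
move=> /fsubset_leq_card + + /fsubset_leq_card.
have : #|` free Y `&` (x |` X)| = (#|` free Y `&` X|).+1.
  have -> : free Y `&` (x |` X) = x |` (free Y `&` X).
    apply/fsetP => z; rewrite !in_fsetI !in_fset1U in_fsetI.
    by case: eqVneq => // ->; rewrite xY.
  by rewrite cardfsU1 in_fsetI (negPf xX) andbF.
have := cardfsID (free Y) X; have := cardfsID Y (free X).
have := cardfsID (x |` X) (free Y); have := cardfsID (free X) Y.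
rewrite (fsetIC (free X) Y) (fsetIC X (free Y)).
lia.
Qed.

End Tight.

(** [m] restricts to a perfect matching of the subgraph induced by [P], given
    as the involution exchanging matched vertices. *)
Definition matching_on (P : {fset T}) (m : T -> T) : Prop :=
  forall u, u \in P -> [/\ m u \in nb u, m u \in P & m (m u) = u].

Lemma hall_cover (S : seq T) P m : hall P -> matching_on P m ->
  exists P' m', [/\ hall P', matching_on P' m', P `<=` P', {in P, m' =1 m} &
    forall u, u \in S -> vert u -> u \in P'].
Proof.
move=> hP mP; elim: S => [|x S [P1 [m1 [hP1 mP1 sP1 eqm1 cov1]]]].
  by exists P, m; split.
have [xin|xout] := boolP (vert x ==> (x \in P1)).
  exists P1, m1; split=> // u; rewrite inE => /predU1P[->|/cov1 //].
  exact/implyP.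
move: xout; rewrite negb_imply => /andP[vx xP1].
have [y [xy yP1 hxy]] := hall_extend hP1 vx xP1.
have neq_yx : y != x.
  by apply/eqP => eyx; have := nb_side xy; rewrite eyx; case: (side x).
pose m2 z := if z == x then y else if z == y then x else m1 z.
have m2x : m2 x = y by rewrite /m2 eqxx.
have m2y : m2 y = x by rewrite /m2 (negPf neq_yx) eqxx.
have m2P z : z \in P1 -> m2 z = m1 z.
  move=> zP1; rewrite /m2; case: eqVneq => [zx|_]; first by rewrite -zx zP1 in xP1.
  by case: eqVneq => // zy; rewrite -zy zP1 in yP1.
exists (x |` (y |` P1)), m2; split=> //.
- move=> u /fset1UP[->|/fset1UP[->|uP1]].
  + by rewrite m2x m2y xy !in_fset1U eqxx orbT.
  + by rewrite m2y m2x nb_sym xy !in_fset1U eqxx.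
  + by have [? m1P1 ?] := mP1 u uP1; rewrite !m2P // !in_fset1U m1P1 !orbT.
- by apply: (fsubset_trans sP1); rewrite !fsubsetU ?fsubset_refl ?orbT.
- by move=> z zP; rewrite m2P ?eqm1 //; apply: (fsubsetP sP1).
- move=> u; rewrite inE => /predU1P[->|uS vu]; rewrite !in_fset1U ?eqxx //.
  by rewrite cov1 ?orbT.
Qed.

End HallStep.

(** * Large correct matchings have extendable restrictions *)

Section LocalToGlobal.
Local Open Scope fset_scope.

Variables (vert side : pred nat) (nb : nat -> {fset nat}).
Hypothesis nb_sym : forall u v, (v \in nb u) = (u \in nb v).

(** [f] gives every vertex below [t] a neighbour, and is an involution as far as
    this can be seen below [t]. *)
Definition correct t (f : nat -> nat) : bool :=
  all (fun u => vert u ==> ((f u \in nb u) && ((f u < t) ==> (f (f u) == u))))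
    (iota 0 t).

Lemma correctP t f : reflect
  (forall u, u < t -> vert u -> f u \in nb u /\ (f u < t -> f (f u) = u))
  (correct t f).
Proof.
apply: (iffP allP) => cf u.
  move=> lt_ut vu; have := cf u; rewrite mem_iota add0n => /(_ lt_ut) /=.
  by rewrite vu /= => /andP[-> /implyP ff]; split=> // /ff/eqP.
rewrite mem_iota add0n => /= lt_ut; apply/implyP => vu.
by have [-> ff] := cf u lt_ut vu; apply/implyP => /ff ->.
Qed.

(** The vertices below [s] and their partners. *)
Definition prefix_dom s (f : nat -> nat) : {fset nat} :=
  [fset u in [seq u <- iota 0 s | vert u] ++
             map f [seq u <- iota 0 s | vert u]].

Lemma prefix_domP s f u :
  reflect (exists v, [/\ v < s, vert v & u = v \/ u = f v])
          (u \in prefix_dom s f).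
Proof.
rewrite in_fset /= mem_cat; apply: (iffP orP) => [[|/mapP[v]]|].
- rewrite mem_filter mem_iota add0n => /= /andP[vu us]; exists u.
  by split=> //; left.
- rewrite mem_filter mem_iota add0n => /= /andP[vv vs] ->; exists v.
  by split=> //; right.
- move=> [v [vs vv [->|->]]]; [left | right; apply: map_f];
    by rewrite mem_filter mem_iota vv.
Qed.

Lemma card_prefix_dom s f : #|` prefix_dom s f| <= s.*2.
Proof.
apply: leq_trans (leq_imfset_card _ _ _) _ => /=.
have : size (seq.filter vert (iota 0 s)) <= s.
  by rewrite size_filter -[X in _ <= X](size_iota 0) count_size.
move=> le_s; apply: leq_trans (size_undup _) _.
by rewrite size_cat size_map -addnn leq_add.
Qed.

(* The successive radii of the shells; neighbours of vertices below [d t] are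
   below [d t.+1]. *)
Variable d : nat -> nat.
Hypothesis nb_d : forall t u v, u < d t -> v \in nb u -> v < d t.+1.
Hypothesis d_mono : forall t, d t <= d t.+1.

(** A pigeonhole argument: the [h] shells are disjoint, so they cannot all meet
    [X]. A shell is two steps wide, so that the parts of [X] on either side of
    it have no common neighbour. *)
Lemma shell_gap (X : {fset nat}) h : #|` X| < h ->
  exists2 j, j < h & forall u, u \in X -> (u < d j.*2) || (d j.+1.*2 <= u).
Proof.
move=> ltXh; apply: contrapT => nogap.
suff : forall j, j <= h -> j <= #|` [fset u in X | u < d j.*2]|.
  move=> /(_ h (leqnn h)); rewrite leqNgt => /negP; apply.
  apply: leq_ltn_trans ltXh; apply/fsubset_leq_card/fsubsetP => u.
  by rewrite !inE => /andP[].
elim=> [|j IHj] // lt_jh.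
have [u uX u_j] : exists2 u, u \in X & d j.*2 <= u < d j.+1.*2.
  apply: contrapT => nou; apply: nogap; exists j => // u uX.
  have [//|le_u] := ltnP u (d j.*2).
  by rewrite /= leqNgt; apply/negP => lt_u; apply: nou; exists u; rewrite ?le_u.
apply: leq_trans (fsubset_leq_card (A := u |` [fset u in X | u < d j.*2]) _).
  rewrite cardfsU1 !inE /= uX [u < _]ltnNge; case/andP: u_j => -> _ /=.
  by rewrite add1n ltnS; apply/IHj/ltnW.
apply/fsubsetP => v; rewrite !inE => /predU1P[->|/andP[/= vX vd]].
  by rewrite /= uX; case/andP: u_j.
by rewrite /= vX; apply: leq_trans vd _; rewrite doubleS (leq_trans (d_mono _)).
Qed.

(** The number [s.*2] bounds that of the vertices deleted, and [h] the size from
    which sets have that many neighbours to spare. *)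
Lemma correct_hall s h f :
  s <= d 0 ->
  hall vert side nb fset0 ->
  (forall c X, onside vert side c fset0 X -> h <= #|` X| ->
     #|` X| + s.*2 <= #|` nbset nb X|) ->
  correct (d h.*2.+1) f ->
  hall vert side nb (prefix_dom s f) /\ matching_on nb (prefix_dom s f) f.
Proof.
move=> le_sd hall0 expand /correctP cf; set P := prefix_dom s f.
have d_le i j : i <= j -> d i <= d j by apply: (homo_leq leqnn leq_trans d_mono).
have cf' t u : t <= h.*2 -> u < d t -> vert u ->
    [/\ f u \in nb u, f u < d t.+1 & f (f u) = u].
  move=> le_th lt_u vu.
  have [|fu ff] := cf u _ vu; first by apply: leq_trans lt_u _; apply: d_le; lia.
  have lt_fu := nb_d lt_u fu; split=> //; apply: ff.
  by apply: leq_trans lt_fu _; apply: d_le; lia.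
have cf0 u : u < s -> vert u -> [/\ f u \in nb u, f u < d 1 & f (f u) = u].
  by move=> lt_us; apply: cf' => //; apply: leq_trans le_sd.
split; last first.
  move=> u /prefix_domP[v [vs vv [->|->]]].
    have [fv _ ffv] := cf0 v vs vv; split=> //.
    by apply/prefix_domP; exists v; split=> //; right.
  have [fv _ ffv] := cf0 v vs vv; split; rewrite ?ffv //; first by rewrite nb_sym.
  by apply/prefix_domP; exists v; split=> //; left.
move=> c X oX.
have oX0 : onside vert side c fset0 X by move=> u /oX/and3P[-> ->].
have [le_hX|lt_Xh] := leqP h #|` X|.
  have := expand c X oX0 le_hX; have := card_prefix_dom s f.
  rewrite cardfsD -/P; have := fsubset_leq_card (fsubsetIr (nbset nb X) P).
  by lia.
(* [X1] is the part of [X] inside the empty shell, [X2] the part beyond it. *)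
have [j lt_jh gap] := shell_gap lt_Xh.
pose X1 := [fset u in X | u < d j.*2]; pose X2 := X `\` X1.
have X1P u : u \in X1 -> [/\ u \in X, u < d j.*2 & vert u].
  by rewrite !inE => /andP[/= uX]; have /and3P[-> _ _] := oX _ uX.
have X2P u : u \in X2 -> u \in X /\ d j.+1.*2 <= u.
  rewrite !inE => /andP[/= + uX]; rewrite uX /= => ud; split=> //.
  by have := gap u uX; rewrite (negPf ud).
have ->: X = X1 `|` X2.
  by apply/fsetP => u; rewrite !inE /=; case: (u \in X); case: (u < _).
have cf1 u : u \in X1 -> [/\ f u \in nb u, f u < d j.*2.+1 & f (f u) = u].
  by case/X1P => uX ud vu; apply: cf' => //; lia.
have card_f : #|` f @` X1| = #|` X1|.
  apply: card_in_imfset => u v uX vX /= eq_fuv.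
  by have [_ _ <-] := cf1 u uX; rewrite eq_fuv; case: (cf1 v vX).
(* The neighbours of [X2] are all free, so here Hall's condition with nothing
   deleted is enough. *)
have hall2 : #|` X2| <= #|` nbset nb X2|.
  have := hall0 c X2; rewrite fsetD0; apply => u /X2P[/oX0 + _].
  by [].
apply: (@leq_trans #|` (f @` X1) `|` nbset nb X2|); last first.
  apply/fsubset_leq_card/fsubsetP => w /fsetUP[/imfsetP[u /= uX1 ->]|].
    have [fu _ ffu] := cf1 u uX1; have [uX _ vu] := X1P u uX1.
    rewrite in_fsetD; apply/andP; split.
      have /and3P[_ _] := oX u uX; apply: contra.
      move=> /prefix_domP[v [vs vv [fuv|fuv]]]; apply/prefix_domP.
        by exists v; split=> //; right; rewrite -fuv.
      exists v; split=> //; left.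
      by rewrite -ffu fuv; case: (cf0 v vs vv).
    by apply/nbsetP; exists u; rewrite // in_fsetU uX1.
  move=> /nbsetP[u uX2 uw]; rewrite in_fsetD; apply/andP; split; last first.
    by apply/nbsetP; exists u; rewrite // in_fsetU uX2 orbT.
  apply/prefix_domP => -[v [vs vv wv]].
  have wd : w < d 1.
    case: wv => ->; last by case: (cf0 v vs vv).
    exact: leq_trans vs (leq_trans le_sd (d_mono 0)).
  have := @nb_d 1 w u wd; rewrite -nb_sym => /(_ uw).
  have [_] := X2P u uX2; have := @d_le 2 j.+1.*2 isT; lia.
have disj : (f @` X1) `&` nbset nb X2 = fset0.
  apply/fsetP => w; rewrite in_fsetI in_fset0; apply/negP => /andP[].
  move=> /imfsetP[u /= /cf1[_ wd _] ->] /nbsetP[v /X2P[_ vd]].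
  rewrite nb_sym => /(nb_d wd); rewrite -doubleS; lia.
have := cardfsUI (f @` X1) (nbset nb X2); rewrite disj cardfs0 addn0 => ->.
have := cardfsUI X1 X2; rewrite card_f.
by lia.
Qed.

End LocalToGlobal.

(** * A computable perfect matching *)

(** A finite sequence of numbers below [b] is coded by a number in base [b]. *)
Lemma digits_exist b n (m : nat -> nat) : (forall u, u < n -> m u < b) ->
  exists w, forall u, u < n -> w %/ b ^ u %% b = m u.
Proof.
elim: n m => [|n IHn] m lt_mb; first by exists 0.
have [u lt_un|w wP] := IHn (fun u => m u.+1); first exact: lt_mb.
have m0b := lt_mb 0 isT; have b_gt0 : 0 < b by apply: leq_ltn_trans m0b.
exists (w * b + m 0) => -[_|u lt_un].
  by rewrite expn0 divn1 modnMDl modn_small.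
by rewrite expnS divnMA divnMDl // (divn_small m0b) addn0 wP.
Qed.

Section Effective.
Local Open Scope fset_scope.
Local Open Scope nat_scope.

Variables (vert side : nat -> bool) (adj : nat -> nat -> bool) (b h : nat -> nat).
Hypothesis adj_sym : forall u v, adj u v = adj v u.
Hypothesis adj_vert : forall u v, adj u v -> vert v.
Hypothesis adj_side : forall u v, adj u v -> side v = ~~ side u.
Hypothesis adj_b : forall u v, adj u v -> v < b u.

(** The neighbours as a finite set; [b] bounds those of each vertex. *)
Definition nb u : {fset nat} := [fset v in iota 0 (b u) | adj u v].

Lemma in_nb u v : (v \in nb u) = adj u v.
Proof.
rewrite !inE /= mem_iota add0n /=.
by have [/adj_b -> //|] := boolP (adj u v); rewrite andbF.
Qed.

Hypothesis h0 : h 0 = 0.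
Hypothesis expand : forall n c X, onside vert side c fset0 X ->
  h n <= #|` X| -> #|` X| + n <= #|` nbset nb X|.

Let nb_sym u v : (v \in nb u) = (u \in nb v).
Proof. by rewrite !in_nb. Qed.

Let nb_vert u v : v \in nb u -> vert v.
Proof. by rewrite in_nb => /adj_vert. Qed.

Let nb_side u v : v \in nb u -> side v = ~~ side u.
Proof. by rewrite in_nb => /adj_side. Qed.

Let hall0 : hall vert side nb fset0.
Proof.
move=> c X oX; rewrite fsetD0; have := @expand 0 c X oX.
by rewrite h0 addn0; apply.
Qed.

(** A bound on [n] and on all neighbours of the vertices below [n]. *)
Definition reach n := n + \sum_(u < n) b u.

Lemma leq_reach n : n <= reach n. Proof. exact: leq_addr. Qed.

Lemma adj_reach n u v : u < n -> adj u v -> v < reach n.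
Proof.
move=> lt_un /adj_b lt_vb; apply: leq_trans lt_vb _.
by rewrite /reach (bigD1 (Ordinal lt_un)) //= addnCA leq_addr.
Qed.

(** The number of steps to be explored beyond the vertices below [s] before the
    matching of these can be trusted, and the bound reached by them. *)
Definition radius s := (h s.*2).*2.+1.
Definition horizon s := iter (radius s) reach s.
(** At stage [s], the number [w] codes a matching of the vertices below
    [horizon s]: the partner of [u] is the digit of rank [u] of [w] in a base
    that exceeds all neighbours of these vertices. *)
Definition base s := (reach (horizon s)).+1.
Definition dec s w u := w %/ base s ^ u %% base s.
Definition good s w := correct vert nb (horizon s) (dec s w).

(** The code [w'] continues [w] to the next stage. Nothing is asked when [w] is
    not good, which makes the search for [w'] total. *)
Definition extends s w w' :=
  good s w ==> (good s.+1 w' &&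
    all (fun u => vert u ==> (dec s.+1 w' u == dec s w u)) (iota 0 s)).

Lemma leq_iter_reach n s : s <= iter n reach s.
Proof. by elim: n => //= n /leq_trans -> //; exact: leq_reach. Qed.

Lemma good_exists s P m : hall vert side nb P -> matching_on nb P m ->
  exists w, good s w /\ forall u, u \in P -> u < horizon s -> dec s w u = m u.
Proof.
move=> hP mP.
have [P' [m' [hP' mP' sP eqm cov]]] :=
  hall_cover nb_sym nb_side (iota 0 (horizon s)) hP mP.
have m'P u : u < horizon s -> vert u -> adj u (m' u) /\ m' (m' u) = u.
  move=> lt_u vu; have [|] := mP' u _; last by rewrite in_nb.
  by apply: cov => //; rewrite mem_iota.
have [u lt_u|w wP] :=
    @digits_exist (base s) (horizon s) (fun u => if vert u then m' u else 0).
  rewrite ltnS; case: ifP => // vu; apply: ltnW.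
  by have [um _] := m'P u lt_u vu; apply: adj_reach um.
have dec_m' u : u < horizon s -> vert u -> dec s w u = m' u.
  by move=> lt_u vu; rewrite /dec wP // vu.
exists w; split; last first.
  move=> u uP lt_u; rewrite -eqm // dec_m' //.
  by have [mu _ _] := mP u uP; move: mu; rewrite nb_sym; apply: nb_vert.
apply/correctP => u lt_u vu; rewrite dec_m' // in_nb.
have [uu mmu] := m'P u lt_u vu; split=> // lt_mu.
by rewrite dec_m' //; apply: adj_vert uu.
Qed.

Lemma good0_exists : exists w, good 0 w.
Proof.
have [|w [gw _]] := @good_exists 0 fset0 id hall0; last by exists w.
by move=> u; rewrite in_fset0.
Qed.

Lemma extends_exists s w : exists w', extends s w w'.
Proof.
rewrite /extends; have [gw|] := boolP (good s w); last by exists 0.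
have [||||hP mP] := @correct_hall vert side nb nb_sym (fun t => iter t reach s)
    _ _ s (h s.*2) (dec s w) _ hall0 _ gw.
- by move=> t u v lt_u; rewrite in_nb; apply: adj_reach.
- by move=> t /=; apply: leq_reach.
- by [].
- by move=> c X oX; exact: (@expand _ c X oX).
have [w' [gw' eqw']] := good_exists s.+1 hP mP.
exists w'; rewrite gw' /=; apply/allP => u; rewrite mem_iota add0n => /= lt_us.
apply/implyP => vu; apply/eqP/eqw'.
  by apply/prefix_domP; exists u; split=> //; left.
by apply: leq_trans (leq_iter_reach _ _); apply: ltnW.
Qed.

(** Stage [s + 1] takes the least continuation of the code of stage [s]. *)
Definition codes s := primrec (least (good 0)) (fun s w => least (extends s w)) s.

(** The partner of [u], as decided at stage [u + 1] and kept afterwards. *)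
Definition partner u := dec u.+1 (codes u.+1) u.

Lemma codes_good s : good s (codes s).
Proof.
elim: s => [|s IHs] /=; first exact/leastP/good0_exists.
by have /implyP/(_ IHs)/andP[] := leastP (extends_exists s (codes s)).
Qed.

Lemma codes_stable s u : u < s -> vert u -> dec s (codes s) u = partner u.
Proof.
elim: s => // s IHs; rewrite ltnS leq_eqVlt => /predU1P[-> //|lt_us] vu.
rewrite -IHs //.
have /implyP/(_ (codes_good s))/andP[_] := leastP (extends_exists s (codes s)).
by move=> /allP/(_ u); rewrite mem_iota lt_us => /(_ isT)/implyP/(_ vu)/eqP.
Qed.

Lemma partnerP u : vert u -> adj u (partner u) /\ partner (partner u) = u.
Proof.
move=> vu; have adj_partner : adj u (partner u).
  have /correctP/(_ u) := codes_good u.+1; rewrite -in_nb.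
  by case=> //; apply: leq_trans (leq_iter_reach _ _).
split=> //; pose s := (maxn u (partner u)).+1.
have lt_us : u < s by rewrite ltnS leq_maxl.
have lt_ps : partner u < s by rewrite ltnS leq_maxr.
have lt_h x : x < s -> x < horizon s.
  by move=> lt_xs; apply: leq_trans (leq_iter_reach _ _).
have /correctP/(_ u (lt_h _ lt_us) vu)[_] := codes_good s.
rewrite codes_stable // => /(_ (lt_h _ lt_ps)).
by rewrite codes_stable //; apply: adj_vert adj_partner.
Qed.

Hypothesis computable_vert : computableb (fun e => vert (e 0)).
Hypothesis computable_adj : computableb (fun e => adj (e 0) (e 1)).
Hypothesis computable_b : computable (fun e => b (e 0)).
Hypothesis computable_h : computable (fun e => h (e 0)).

Lemma computable_reach : computable (fun e => reach (e 0)).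
Proof.
apply: computable_add; first exact: computable_var.
by apply: (computable_sum (F := fun i _ => b i)) (computable_var 0).
Qed.

Lemma computable_horizon : computable (fun e => horizon (e 0)).
Proof.
have -> : (fun e : nat -> nat => horizon (e 0)) = fun e =>
    primrec (e 0) (fun _ y => reach y) (h (e 0 + e 0) + h (e 0 + e 0)).+1.
  apply/funext => e; rewrite /horizon /radius !addnn.
  by elim: (_.+1) => //= n ->.
have ch : computable (fun e => h (e 0 + e 0)).
  by apply: computable_app1 computable_h _; apply: computable_add; exact: computable_var.
apply: (computable_primrec (base := fun e => e 0) (step := fun _ y _ => reach y)).
- exact: computable_var.
- exact: computable_app1 computable_reach (computable_var 1).
- exact/computable_succ/computable_add.
Qed.

Lemma computable_dec : computable (fun e => dec (e 0) (e 1) (e 2)).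
Proof.
have cb : computable (fun e => base (e 0)).
  by apply/computable_succ; apply: computable_app1 computable_reach computable_horizon.
apply: computable_mod => //; apply: computable_div; first exact: computable_var.
by apply: computable_exp => //; apply: computable_var.
Qed.

Lemma computableb_good : computableb (fun e => good (e 0) (e 1)).
Proof.
pose body u (e : nat -> nat) := vert u ==> (adj u (dec (e 0) (e 1) u) &&
  ((dec (e 0) (e 1) u < horizon (e 0)) ==>
   (dec (e 0) (e 1) (dec (e 0) (e 1) u) == u))).
have -> : (fun e : nat -> nat => good (e 0) (e 1)) =
    fun e => all (body ^~ e) (iota 0 (horizon (e 0))).
  by apply/funext => e; apply: eq_all => u /=; rewrite /body in_nb.
apply: computableb_all; last exact: computable_horizon.
have cd : computable (fun e => dec (e 1) (e 2) (e 0)).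
  by apply: (computable_app3 computable_dec); apply: computable_var.
apply: computableb_imp => //; apply: computableb_and.
  exact: computableb_app2 computable_adj (computable_var 0) cd.
apply: computableb_imp.
  apply: computableb_leq; first exact: computable_succ.
  exact: computable_app1 computable_horizon (computable_var 1).
apply: computableb_eq; last exact: computable_var.
by apply: (computable_app3 computable_dec) => //; apply: computable_var.
Qed.

Lemma computableb_extends : computableb (fun e => extends (e 1) (e 2) (e 0)).
Proof.
apply: computableb_imp.
  by apply: computableb_app2 computableb_good _ _; apply: computable_var.
apply: computableb_and.
  apply: computableb_app2 computableb_good _ (computable_var 0).
  exact/computable_succ/computable_var.
pose body u (e : nat -> nat) :=
  vert u ==> (dec (e 1).+1 (e 0) u == dec (e 1) (e 2) u).
apply: (computableb_all (P := body)) (computable_var 1).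
apply: computableb_imp => //; apply: computableb_eq;
  apply: (computable_app3 computable_dec);
  by [apply: computable_var | apply/computable_succ/computable_var].
Qed.

Lemma computable_partner : computable (fun e => partner (e 0)).
Proof.
apply: (computable_app3 computable_dec); last exact: computable_var.
  exact/computable_succ/computable_var.
apply: (computable_primrec (base := fun=> least (good 0))
  (step := fun s w _ => least (extends s w))).
- exact: computable_const.
- apply: (computable_least (P := fun w' e => extends (e 0) (e 1) w')).
    exact: computableb_extends.
  by move=> e; apply: extends_exists.
- exact/computable_succ/computable_var.
Qed.

End Effective.

(** A computable bipartite graph on the natural numbers, with computable bounds
    [b] on the neighbours and with the expanding Hall condition for a computable
    [h], has a computable perfect matching. Vertices are the numbers satisfying
    [vert], and [side] tells the two sides apart. *)
Theorem computable_matching (vert side : nat -> bool) (adj : nat -> nat -> bool)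
    (b h : nat -> nat) :
  (forall u v, adj u v = adj v u) ->
  (forall u v, adj u v -> vert v) ->
  (forall u v, adj u v -> side v = ~~ side u) ->
  (forall u v, adj u v -> v < b u) ->
  h 0 = 0 ->
  (forall n c X, onside vert side c fset0%fset X ->
     h n <= #|` X| -> #|` X| + n <= #|` nbset (nb adj b) X|) ->
  computableb (fun e => vert (e 0)) ->
  computableb (fun e => adj (e 0) (e 1)) ->
  computable (fun e => b (e 0)) -> computable (fun e => h (e 0)) ->
  exists f, computable (fun e => f (e 0)) /\
    forall u, vert u -> adj u (f u) /\ f (f u) = u.
Proof.
move=> adj_sym adj_vert adj_side adj_b h0 expand c_vert c_adj c_b c_h.
exists (partner vert adj b h); split.
  exact: (computable_partner adj_sym adj_vert adj_side adj_b h0 expand).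
by move=> u; apply: (partnerP adj_sym adj_vert adj_side adj_b h0 expand).
Qed.

(** * Recovering neighbourhoods from degrees *)

Lemma count_sum (P : pred nat) m : \sum_(j < m) P j = count P (iota 0 m).
Proof.
have -> : iota 0 m = index_iota 0 m by rewrite /index_iota subn0.
rewrite -sum1_count [RHS]big_mkcond big_mkord.
by apply: eq_bigr => j _; case: (P j).
Qed.

(** Once all the elements of [N] have been counted, none is left. *)
Lemma count_mem_bound (N : {fset nat}) m :
  \sum_(j < m) ((j : nat) \in N) = #|` N| -> forall j, j \in N -> j < m.
Proof.
rewrite count_sum -size_filter => eN j jN.
have sub : {subset [seq j <- iota 0 m | j \in N] <= enum_fset N}.
  by move=> i; rewrite mem_filter => /andP[].
have [_ eqN] := uniq_min_size (filter_uniq _ (iota_uniq 0 m)) sub (eq_leq (esym eN)).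
have : j \in [seq j <- iota 0 m | j \in N] by rewrite eqN.
by rewrite mem_filter mem_iota => /andP[_ /andP[]].
Qed.

Lemma count_mem_exists (N : {fset nat}) :
  exists m, \sum_(j < m) ((j : nat) \in N) = #|` N|.
Proof.
exists (\max_(j <- enum_fset N) j).+1; rewrite count_sum -size_filter.
apply/perm_size/uniq_perm; rewrite ?filter_uniq ?iota_uniq ?fset_uniq // => j.
rewrite mem_filter mem_iota add0n /= ltnS.
apply: andb_idr => jN.
exact: (leq_bigmax_seq (F := fun j => j) j jN isT).
Qed.

(** * Copying the left vertices *)

Section Blowup.
Variables (k : nat).
Hypothesis k_gt0 : 0 < k.

(** The [k] copies [j * k], ..., [j * k + k - 1] of each element [j] of [N]. *)
Definition blowup (N : {fset nat}) : seq nat :=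
  [seq j * k + c | j <- enum_fset N, c <- iota 0 k].

Lemma size_blowup N : size (blowup N) = #|` N| * k.
Proof. by rewrite size_allpairs size_iota. Qed.

Lemma mem_blowup N u : (u \in blowup N) = (u %/ k \in N).
Proof.
apply/allpairsP/idP => [[[j c] /= [jN + ->]]|uN].
  rewrite mem_iota add0n => /= lt_ck.
  by rewrite divnMDl // divn_small // addn0.
exists (u %/ k, u %% k); split=> //=; last exact: divn_eq.
by rewrite mem_iota add0n ltn_mod.
Qed.

Lemma blowup_uniq N : uniq (blowup N).
Proof.
apply: allpairs_uniq; rewrite ?fset_uniq ?iota_uniq //.
move=> _ _ /allpairsP[[i c] /= [_ + ->]] /allpairsP[[j d] /= [_ + ->]].
rewrite !mem_iota !add0n => /= ck dk /= eq_u.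
have : (i * k + c) %/ k = (j * k + d) %/ k by rewrite eq_u.
have : (i * k + c) %% k = (j * k + d) %% k by rewrite eq_u.
by rewrite !divnMDl // !modnMDl !divn_small // !addn0 !modn_small // => -> ->.
Qed.

End Blowup.

Section Graph.
Variables (V : choiceType) (G : bipartite_graph V) (nu : nat -> V).
Hypothesis nu_bij : bijective nu.

(** The graph transported to the natural numbers along [nu]. *)
Definition leftb i := `[< lefts G (nu i) >].
Definition adjb i j := `[< nbrs G (nu i) (nu j) >].

Lemma edge_leftb i j : edge G (nu i, nu j) -> leftb i /\ ~~ leftb j.
Proof.
move=> /(edge_sub (b := G))[/= li rj]; split; first exact/asboolP.
apply/asboolPn => lj.
by have : (lefts G `&` rights G)%classic (nu j) by []; rewrite lefts_rights_disjoint.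
Qed.

Lemma rights_leftb i : rights G (nu i) <-> ~~ leftb i.
Proof.
split=> [ri|/asboolPn nli].
  apply/asboolPn => li.
  by have : (lefts G `&` rights G)%classic (nu i) by []; rewrite lefts_rights_disjoint.
have : (lefts G `|` rights G)%classic (nu i) by rewrite lefts_rights_cover.
by case.
Qed.

Lemma adjb_sym i j : adjb i j = adjb j i.
Proof. by apply/asboolP/asboolP => -[]; [right|left|right|left]. Qed.

Lemma adjb_leftb i j : adjb i j -> leftb j = ~~ leftb i.
Proof. by case/asboolP => /edge_leftb[]; do 2!case: leftb. Qed.

Lemma adjb_edge i j : adjb i j -> leftb i -> edge G (nu i, nu j).
Proof. by case/asboolP => // /edge_leftb[_ /negPf ->]. Qed.

Lemma ncard_image (N : {fset nat}) : ncard (nu @` [set` N])%classic = #|` N|.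
Proof.
rewrite /ncard fset_set_image; last exact: finite_fset.
by rewrite set_fsetK card_imfset //; exact: bij_inj.
Qed.

Lemma adjb_finite i : locally_finite G ->
  exists N : {fset nat}, (forall j, (j \in N) = adjb i j) /\
    #|` N| = ncard (nbrs G (nu i)).
Proof.
move=> /(_ (nu i)) fin; have [mu nuK muK] := nu_bij.
exists [fset mu x | x in fset_set (nbrs G (nu i))]%fset; split=> [j|]; last first.
  by rewrite card_imfset //; exact: can_inj muK.
apply/imfsetP/asboolP => /= [[x + ->]|ij].
  by rewrite in_fset_set // inE muK.
by exists (nu j); rewrite ?nuK // in_fset_set // inE.
Qed.

(** Neighbours can be bounded computably when their number is computable: count
    them until all have been seen. *)
Lemma adjb_bound (f : nat -> nat) : locally_finite G ->
  (forall i, f i = ncard (nbrs G (nu i))) ->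
  recursive1 f -> computableb (fun e => adjb (e 0) (e 1)) ->
  exists b, computable (fun e => b (e 0)) /\ forall i j, adjb i j -> j < b i.
Proof.
move=> lf fE /recursive1P cf cadj.
pose P m (e : nat -> nat) := \sum_(j < m) adjb (e 0) j == f (e 0).
have PN i : exists N : {fset nat}, [/\ forall j, (j \in N) = adjb i j,
    #|` N| = f i &
    forall m, \sum_(j < m) adjb i j = \sum_(j < m) ((j : nat) \in N)].
  have [N [NP cN]] := adjb_finite i lf; exists N.
  by split=> [//||m]; [rewrite cN fE | apply: eq_bigr => j _; rewrite NP].
have exP e : exists m, P m e.
  have [N [_ cN sN]] := PN (e 0); have [m mP] := count_mem_exists N.
  by exists m; rewrite /P sN mP cN.
exists (fun i => least (P ^~ (fun=> i))); split.
  apply: (computable_least (P := fun m e => P m (fun=> e 0))); last by move=> e.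
  apply: computableb_eq; last exact: computable_app1 cf (computable_var 1).
  apply: (computable_sum (F := fun j e => nat_of_bool (adjb (e 1) j)))
    (computable_var 0).
  by apply: computableb_app2 cadj _ _; apply: computable_var.
move=> i j ij; have [N [NP cN sN]] := PN i.
have := leastP (exP (fun=> i)); rewrite {1}/P sN -cN => /eqP.
by move=> /count_mem_bound; apply; rewrite NP.
Qed.

Variable k : nat.
Hypothesis k_gt0 : 0 < k.

(** The graph with [k] copies of every left vertex: [u] is copy [u %% k] of
    vertex [u %/ k], and only copy 0 is kept on the right. *)
Definition copy_vert u := leftb (u %/ k) || (u %% k == 0).
Definition copy_side u := leftb (u %/ k).
Definition copy_adj u v :=
  [&& adjb (u %/ k) (v %/ k), copy_vert u & copy_vert v].

Variable b : nat -> nat.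
Hypothesis adjb_b : forall i j, adjb i j -> j < b i.
Definition copy_b u := b (u %/ k) * k.

Lemma copy_adj_b u v : copy_adj u v -> v < copy_b u.
Proof. by case/and3P => /adjb_b + _ _; rewrite ltn_divLR. Qed.

Local Notation copy_nb := (nb copy_adj copy_b).

Lemma in_copy_nbset X v : reflect (exists2 u, u \in X & copy_adj u v)
  (v \in nbset copy_nb X).
Proof.
apply: (iffP (nbsetP _ _ _)) => -[u uX uv]; exists u => //; move: uv;
  by rewrite in_nb //; exact: copy_adj_b.
Qed.

(** Copies of left vertices have the same neighbours as the original, while a
    right vertex is joined to all [k] copies of each of its neighbours. Hence
    both halves of the harem condition give the same expanding condition for
    the new graph. *)
Lemma copy_expand (h : nat -> nat) :
  (forall X : set V, finite_set X -> (X `<=` lefts G)%classic -> forall n,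
     h n <= ncard X ->
     (n%:R <= (ncard (nbrs_set G X))%:R - k%:R * (ncard X)%:R :> rat)%R) ->
  (forall Y : set V, finite_set Y -> (Y `<=` rights G)%classic -> forall n,
     h n <= ncard Y ->
     (n%:R <= (ncard (nbrs_set G Y))%:R - 1 / k%:R * (ncard Y)%:R :> rat)%R) ->
  forall n c X, onside copy_vert copy_side c fset0 X ->
    k * h n <= #|` X| -> #|` X| + n <= #|` nbset copy_nb X|.
Proof.
move=> hl hr n c X oX le_hX; set Z := nbset copy_nb X.
have [mu nuK muK] := nu_bij.
pose X' := [fset u %/ k | u in X]%fset; pose N' := [fset v %/ k | v in Z]%fset.
have X'side i : i \in X' -> leftb i = c.
  by move=> /imfsetP[u /= /oX/and3P[_ /eqP <- _] ->].
have leX : #|` X| <= #|` X'| * k.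
  rewrite -size_blowup; apply: uniq_leq_size (fset_uniq _) _ => u uX.
  by rewrite mem_blowup //; apply/imfsetP; exists u.
have leN : #|` N'| <= #|` Z| by apply: leq_imfset_card.
have nbN : (nbrs_set G (nu @` [set` X']) = nu @` [set` N'])%classic.
  apply/seteqP; split=> [y [_ [i /= iX' <-] iy]|_ [_ /imfsetP[v /= vZ ->] <-]].
    exists (mu y); last exact: muK.
    case/imfsetP: (iX') => u /= uX ui; apply/imfsetP; exists (mu y * k) => /=.
      apply/in_copy_nbset; exists u => //; apply/and3P; split.
      - by rewrite mulnK // -ui; apply/asboolP; rewrite muK.
      - by case/and3P: (oX u uX).
      - by rewrite /copy_vert modnMl eqxx orbT.
    by rewrite mulnK.
  case/in_copy_nbset: vZ => u uX /and3P[/asboolP uv _ _].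
  by exists (nu (u %/ k)) => //; exists (u %/ k) => //=; apply/imfsetP; exists u.
have finX : finite_set (nu @` [set` X'])%classic.
  exact/finite_image/finite_fset.
(* A set of left copies has at most [k] elements over each vertex of [X']. *)
case: c oX X'side => oX X'side.
  have := hl _ finX _ n; rewrite nbN !ncard_image lerBrDr -natrM -natrD ler_nat.
  have le_h : h n <= #|` X'|.
    by rewrite -(leq_pmul2l k_gt0) (leq_trans le_hX) // mulnC.
  move=> /(_ _ le_h) le_n; apply: leq_trans leN; apply: leq_trans (le_n _); last first.
    by move=> _ [i /= iX' <-]; apply/asboolP; rewrite -/(leftb i) X'side.
  by rewrite addnC leq_add2l mulnC.
(* On the right there is only one copy of each vertex, and [Z] contains all [k]
   copies of each vertex of [N']. *)
have leX' : #|` X| = #|` X'|.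
  apply/esym/card_in_imfset => u v uX vX /= euv.
  have mod0 w : w \in X -> w %% k = 0.
    move=> /oX/and3P[+ /eqP + _]; rewrite /copy_vert /copy_side.
    by move=> /orP[->//|/eqP].
  by rewrite (divn_eq u k) (divn_eq v k) euv !mod0.
have leZ : #|` N'| * k <= #|` Z|.
  rewrite -size_blowup; apply: uniq_leq_size (blowup_uniq k_gt0 _) _ => v.
  rewrite mem_blowup // => /imfsetP[w /= /in_copy_nbset[u uX /and3P[uw vu vw]] vwk].
  apply/in_copy_nbset; exists u => //; apply/and3P; split; rewrite ?vwk //.
  rewrite /copy_vert vwk (adjb_leftb uw).
  by case/and3P: (oX u uX) => _ /eqP; rewrite /copy_side => ->.
have := hr _ finX _ n; rewrite nbN !ncard_image.
have le_h : h n <= #|` X'|.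
  by rewrite -leX' (leq_trans _ le_hX) // leq_pmull.
have kR : (0 < k%:R :> rat)%R by rewrite ltr0n.
rewrite lerBrDr -(ler_pM2r kR) mulrDl mul1r mulrAC mulVf ?gt_eqF // mul1r.
rewrite -!natrM -natrD ler_nat => /(_ _ le_h) le_n.
apply: leq_trans leZ; apply: leq_trans (le_n _); last first.
  by move=> _ [i /= iX' <-]; apply/rights_leftb; rewrite X'side.
by rewrite leX' addnC leq_add2r leq_pmulr.
Qed.

End Graph.

(** * Perfect (1,k)-matchings *)

Theorem theorem6p7 (k : nat) (V : choiceType) (G : bipartite_graph V)
    (nu : nat -> V) :
  1 <= k ->
  highly_computable G nu ->
  computably_bipartite G nu ->
  ceHhc G k ->
  exists M : set (V * V), computable_perfect_matching G nu k M.
Proof.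
move=> k_gt0 [[nu_bij cE] lf [f [rf fE]]] [_ cL] [h [rh h0 hl hr]].
have cleft : computableb (fun e => leftb G nu (e 0)) by exact: computable_setP cL.
have cedge := computable_relP cE.
have cadjb : computableb (fun e => adjb G nu (e 0) (e 1)).
  have -> : (fun e : nat -> nat => adjb G nu (e 0) (e 1)) =
      fun e => `[< edge G (nu (e 0), nu (e 1)) >] || `[< edge G (nu (e 1), nu (e 0)) >].
    by apply/funext => e; rewrite -asbool_or.
  apply: computableb_or; first exact: cedge.
  apply: (computableb_app2 (P := fun i j => `[< edge G (nu i, nu j) >])) cedge _ _;
    exact: computable_var.
have [b [cb adjb_b]] := adjb_bound nu_bij lf fE rf cadjb.
have cdiv a : computable a -> computable (fun e => a e %/ k).
  by move=> ca; apply: computable_div ca (computable_const k).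
have cvert : computableb (fun e => copy_vert G nu k (e 0)).
  apply: computableb_or.
    exact: computableb_app1 cleft (cdiv _ (computable_var 0)).
  apply: computableb_eq (computable_const 0).
  exact: computable_mod (computable_var 0) (computable_const k).
have cadj : computableb (fun e => copy_adj G nu k (e 0) (e 1)).
  apply: computableb_and.
    by apply: computableb_app2 cadjb _ _; apply/cdiv/computable_var.
  by apply: computableb_and; apply: computableb_app1 cvert (computable_var _).
have [||||||||||m [cm mP]] := @computable_matching (copy_vert G nu k)
    (copy_side G nu k) (copy_adj G nu k) (copy_b k b) (fun n => k * h n).
- by move=> u v; rewrite /copy_adj adjb_sym; congr (_ && _); rewrite andbC.
- by move=> u v /and3P[].
- by move=> u v /and3P[/adjb_leftb].
- exact: copy_adj_b.
- by rewrite h0 muln0.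
- exact: copy_expand.
- by [].
- by [].
- exact: computable_mul (computable_app1 cb (cdiv _ (computable_var 0)))
    (computable_const k).
- by apply: computable_mul; [apply: computable_const | apply/recursive1P].
have nu_inj := bij_inj nu_bij; have [mu nuK muK] := nu_bij.
(* [p c i] is the right vertex matched to copy [c] of [i]. *)
pose p (c : nat) i := m (i * k + c) %/ k.
have leftP i c : leftb G nu i -> c < k ->
    [/\ edge G (nu i, nu (p c i)), m (i * k + c) = p c i * k & m (p c i * k) = i * k + c].
  move=> li lt_ck.
  have ik : (i * k + c) %/ k = i by rewrite divnMDl // divn_small // addn0.
  have [|+ mm] := mP (i * k + c); first by rewrite /copy_vert ik li.
  move=> /and3P[]; rewrite ik -/(p c i) => ip _; rewrite /copy_vert -/(p c i).
  rewrite (adjb_leftb ip) li /= => /eqP m0.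
  have mE : m (i * k + c) = p c i * k by rewrite {1}(divn_eq (m _) k) m0 addn0.
  by split; [apply: adjb_edge | | rewrite -mE].
have p_inj i c d : leftb G nu i -> c < k -> d < k -> p c i = p d i -> c = d.
  move=> li ck dk epp; have [_ _ mc] := leftP i c li ck.
  have [_ _] := leftP i d li dk; rewrite -epp mc => /eqP.
  by rewrite eqn_add2l => /eqP.
exists [set xy | exists i c, [/\ leftb G nu i, c < k & xy = (nu i, nu (p c i))]]%classic.
split; first split.
- by move=> _ [i [c [li ck ->]]]; case: (leftP i c li ck).
- move=> a; rewrite -[a]muK; set i := mu a => /asboolP li.
  have -> : [set y | rights G y /\ exists j c,
      [/\ leftb G nu j, c < k & (nu i, y) = (nu j, nu (p c j))]]%classic =
      ((fun c => nu (p c i)) @` `I_k)%classic.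
    apply/seteqP; split=> [y [_ [j [c [_ ck [/nu_inj <- ->]]]]]|_ [c /= ck <-]].
      by exists c.
    have [/(edge_sub (b := G))[_ /= rp] _ _] := leftP i c li ck.
    by split=> //; exists i, c.
  apply: inj_card_eq => c d; rewrite !inE /= => ck dk /nu_inj.
  exact: p_inj.
- move=> y; rewrite -[y]muK; set j := mu y => /rights_leftb lj.
  have [|jm mm] := mP (j * k); first by rewrite /copy_vert modnMl eqxx orbT.
  case/and3P: jm => jm _ _; rewrite mulnK // in jm.
  set i := m (j * k) %/ k in jm.
  have li : leftb G nu i by rewrite (adjb_leftb jm).
  exists (nu i); split=> [|_ [_ [i' [c [li' ck [-> /nu_inj jE]]]]]].
    split; first exact/asboolP.
    exists i, (m (j * k) %% k); split=> //; first by rewrite ltn_mod.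
    by rewrite /p -divn_eq mm mulnK.
  have [_ _] := leftP i' c li' ck; rewrite -jE /i => ->.
  by rewrite divnMDl // divn_small // addn0.
- exists (fun c : 'I_k => p c); split=> [c|i /asboolP li].
    apply/recursive1P/cdiv/(computable_app1 cm).
    apply: computable_add; last exact: computable_const.
    exact: computable_mul (computable_var 0) (computable_const k).
  split=> [c d /= epp|c]; last by exists i, c; split.
  exact/val_inj/(p_inj i c d li (ltn_ord c) (ltn_ord d) epp).
- exists (fun j => m (j * k) %/ k); split=> [|j /asboolPn lj].
    apply/recursive1P/cdiv/(computable_app1 cm).
    exact: computable_mul (computable_var 0) (computable_const k).
  have [|jm mm] := mP (j * k); first by rewrite /copy_vert modnMl eqxx orbT.
  case/and3P: jm => jm _ _; rewrite mulnK // in jm.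
  exists (m (j * k) %/ k), (m (j * k) %% k); rewrite (adjb_leftb jm) ltn_mod.
  by split=> //; rewrite /p -divn_eq mm mulnK.
Qed.
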